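(* There is a constant $A>0$ with the following property. Let $\Lambda$ be a locally compact Polish space and $\lambda$ a positive Radon measure on $\Lambda$. Let $K:\Lambda \times \Lambda \to \mathbb{C}$ be a measurable function such that the associated integral operator on $\mathbb{L}_2(\lambda)$ is a self-adjoint projection of finite rank, and let $r(K)$ be the rank of $K$. Then for any bounded $f:\Lambda\to\mathbb{R}$ the linear statistic $X_f$ of the determinantal point process with kernel $K$ satisfies $$\operatorname{Var} X_f\leq 2\, r(K) \|f\|_\infty^2 .$$ In particular, for every $\varepsilon>0$, $$P(\left|X_f-\mathbb{E} X_f \right|\geq \varepsilon) \leq \begin{cases} 2\exp \left(- \frac{\varepsilon^2 }{8 A\, r(K) \|f\|_\infty^2}\right), &\text{if } \varepsilon <\frac{4 A\, r(K) \|f\|_\infty}{3}, \\[4pt] 2\exp \left(- \frac{\varepsilon }{6 \|f\|_\infty} \right), &\text{if } \varepsilon \geq \frac{4 A\, r(K) \|f\|_\infty}{3 }, \end{cases}$$ where the constant $A$ does not depend on $f$, $K$ or $\varepsilon$.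
   Context: The kernel satisfies $K(y,x)=\overline{K(x,y)}$ and $\int K(x,y)K(y,z)\,d\lambda(y)=K(x,z)$ for $x,z\in\Lambda$, and its integral operator has finite rank $N=r(K)$. Such a $K$ defines a determinantal point process on $\Lambda$ with reference measure $\lambda$: a random point configuration $\{x_j\}$ in $\Lambda$ such that for every bounded measurable $\phi$, $$\mathbb{E}\Big[\prod_j(1+\phi(x_j))\Big]=\sum_{k=0}^N\frac{1}{k!}\int\cdots\int\phi(x_1)\cdots\phi(x_k)\det\big(K(x_i,x_j)\big)_{i,j=1}^k\,d\lambda(x_1)\cdots d\lambda(x_k).$$ For a bounded measurable $f$, the linear statistic is $X_f=\sum_j f(x_j)$, and $\|f\|_\infty$ is the supremum norm (in the tail bound take $f\neq0$; for $f=0$ it is trivial). *)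

(* Defs.v *)
From HB Require Import structures.
From mathcomp Require Import all_boot all_order all_algebra.
From mathcomp Require Import all_classical all_reals all_analysis.
From mathcomp.real_closed Require Import complex.

Set Implicit Arguments.
Unset Strict Implicit.
Unset Printing Implicit Defensive.
Import Order.TTheory GRing.Theory Num.Theory.
Import numFieldNormedType.Exports.

Local Open Scope classical_set_scope.
Local Open Scope complex_scope.
Local Open Scope ring_scope.

(* A Polish space is presented as a separable [completeMetricType R]; the
   library's complete spaces and measurable types carry a point, so that the
   spaces considered are nonempty. *)
#[short(type="completeMetricType")]
HB.structure Definition CompleteMetric (R : numDomainType) :=
  {T of CompletePseudoMetric R T & Metric R T}.

Definition separable_space (T : topologicalType) : Prop :=
  exists2 S : set T, countable S & dense S.

Notation borel T := (g_sigma_algebraType (@open T)).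

Definition radon_measure (R : realType) (T : ptopologicalType)
    (mu : {measure set (borel T) -> \bar R}) : Prop :=
  [/\ forall C : set T, compact C -> (mu C < +oo)%E,
      forall B : set (borel T), measurable B ->
        mu B = ereal_inf [set mu U | U in [set U : set T | open U /\ B `<=` U]]
    & forall U : set T, open U ->
        mu U = ereal_sup [set mu C | C in [set C : set T | compact C /\ C `<=` U]]].

Section ComplexIntegral.
Context {d : measure_display} {T : measurableType d} {R : realType}.
Variable mu : {measure set T -> \bar R}.

Definition cmeasurable {d'} {S : measurableType d'} (g : S -> R[i]) : Prop :=
  measurable_fun [set: S] (fun x => complex.Re (g x)) /\
  measurable_fun [set: S] (fun x => complex.Im (g x)).

Definition cintegrable (g : T -> R[i]) : Prop :=
  mu.-integrable [set: T] (fun x => (complex.Re (g x))%:E) /\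
  mu.-integrable [set: T] (fun x => (complex.Im (g x))%:E).

Definition cintegral (g : T -> R[i]) : R[i] :=
  (\int[mu]_x complex.Re (g x)) +i* (\int[mu]_x complex.Im (g x)).

Definition L2 (g : T -> R[i]) : Prop :=
  cmeasurable g /\
  mu.-integrable [set: T] (fun x => (complex.Re (g x) ^+ 2 + complex.Im (g x) ^+ 2)%:E).

Definition L2_inner (g h : T -> R[i]) : R[i] :=
  cintegral (fun x => g x * conjc (h x)).

Definition integral_operator (K : T -> T -> R[i]) (g : T -> R[i]) : T -> R[i] :=
  fun x => cintegral (fun y => K x y * g y).

(* Elements of $L_2$ are represented by functions, so that equalities in $L_2$,
   linear independence included, are modulo almost everywhere equality. *)
Definition acts_on_L2 (K : T -> T -> R[i]) : Prop :=
  forall g, L2 g ->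
    {ae mu, forall x, cintegrable (fun y => K x y * g y)} /\
    L2 (integral_operator K g).

Definition self_adjoint_op (K : T -> T -> R[i]) : Prop :=
  forall g h, L2 g -> L2 h ->
    L2_inner (integral_operator K g) h = L2_inner g (integral_operator K h).

Definition idempotent_op (K : T -> T -> R[i]) : Prop :=
  forall g, L2 g ->
    {ae mu, forall x,
      integral_operator K (integral_operator K g) x = integral_operator K g x}.

(* The range of the operator has a basis with [N] elements. *)
Definition op_rank (K : T -> T -> R[i]) (N : nat) : Prop :=
  exists e : 'I_N -> T -> R[i],
    [/\ forall i, exists2 h, L2 h & e i = integral_operator K h,
        forall c : 'I_N -> R[i],
          {ae mu, forall x, \sum_(i < N) c i * e i x = 0} -> forall i, c i = 0
      & forall g, L2 g -> exists c : 'I_N -> R[i],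
          {ae mu, forall x,
            integral_operator K g x = \sum_(i < N) c i * e i x}].

(* The pointwise identities fix the values of [K] on the diagonal, which its
   operator does not determine. *)
Record projection_kernel (K : T -> T -> R[i]) (N : nat) : Prop :=
  ProjectionKernel {
    pk_measurable : cmeasurable (fun p : T * T => K p.1 p.2);
    pk_hermitian : forall x y, K y x = conjc (K x y);
    pk_integrable : forall x z, cintegrable (fun y => K x y * K y z);
    pk_reproducing : forall x z, cintegral (fun y => K x y * K y z) = K x z;
    pk_L2 : acts_on_L2 K;
    pk_self_adjoint : self_adjoint_op K;
    pk_idempotent : idempotent_op K;
    pk_rank : op_rank K N }.

Fixpoint iterated_integral (k : nat) : (k.-tuple T -> R) -> R :=
  match k with
  | 0 => fun F => F [tuple]
  | k'.+1 => fun F =>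
      \int[mu]_x iterated_integral (fun t : k'.-tuple T => F [tuple of x :: t])
  end.

End ComplexIntegral.

(* A finite point configuration (a finite multiset) is represented by a list of
   its points. Nothing depends on the order of the list: measurability of a
   random configuration is that of the numbers of points in measurable sets. *)
Definition random_configuration {d d'} {Omega : measurableType d'}
    {T : measurableType d} (xi : Omega -> seq T) : Prop :=
  forall B : set T, measurable B ->
    measurable_fun [set: Omega] (fun w => count [in B] (xi w)).

(* The determinant is that of a Hermitian matrix, hence is real. A projection
   kernel of rank [N] gives almost surely [N] points, which is why it is enough
   to consider finite configurations. *)
Definition determinantal_process {d d'} {R : realType}
    {Omega : measurableType d'} {T : measurableType d} (P : probability Omega R)
    (mu : {measure set T -> \bar R}) (K : T -> T -> R[i]) (N : nat)
    (xi : Omega -> seq T) : Prop :=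
  random_configuration xi /\
  forall phi : T -> R, measurable_fun [set: T] phi -> bounded_fun phi ->
    ('E_P[fun w => (\prod_(x <- xi w) (1 + phi x))%R])%E =
    (\sum_(k < N.+1) (k`!%:R)^-1 *
       iterated_integral mu (fun t : k.-tuple T =>
         (\prod_(i < k) phi (tnth t i)) *
         complex.Re (\det (\matrix_(i < k, j < k) K (tnth t i) (tnth t j)))))%:E.

Definition linear_statistic {R : realType} {T Omega : Type} (f : T -> R)
    (xi : Omega -> seq T) (w : Omega) : R :=
  \sum_(x <- xi w) f x.

Definition sup_norm {R : realType} {T : Type} (f : T -> R) : R :=
  sup (range (fun x => `|f x|)).

(* Main.v *)
Require Import Defs.
From mathcomp Require Import all_boot all_order all_algebra fingroup perm.
From mathcomp Require Import all_classical all_reals all_analysis.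
From mathcomp Require Import measurable_realfun.
From mathcomp.real_closed Require Import complex.
From mathcomp Require Import sesquilinear spectral ring lra.
Set Implicit Arguments.
Unset Strict Implicit.
Unset Printing Implicit Defensive.
Import Order.TTheory GRing.Theory Num.Theory.
Import numFieldNormedType.Exports.
Local Open Scope classical_set_scope.
Local Open Scope ring_scope.

(* Write K(x, z) = sum_a u_a(x) conj(u_a(z)) with u_1, ..., u_N orthonormal.
   For a bounded phi, the u_a may be rotated by a unitary matrix so that
   int phi u_a conj(u_b) = p_a delta_ab, and then the correlation expansion of
   E prod_j (1 + phi(x_j)) sums up to prod_a (1 + p_a). For phi = e^(t f) - 1 the
   factor 1 + p_a is the Laplace transform of f under the probability density
   |u_a|^2, so that, with s = ||f|| and m = int f(x) K(x, x) (which does not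
   depend on the rotation),
     E e^(t (X_f - m)) <= e^(N t^2 s^2)   whenever |t| s <= 3/16.
   Letting t tend to 0 gives E X_f = m and Var X_f <= 2 N s^2. The tail bound,
   with A = 2, is Chernoff's inequality at t = 9 eps / (128 N s^2) in the first
   regime and at t = 3 / (16 s) in the second. *)

(** * Complex integrals *)

(** The rotation diagonalizes the weighted Gram matrix of the u_a, Hermitian because phi is real. It
    depends on phi, hence on t, so no single basis serves every t. This does no harm: the bound on
    each factor sees the basis only through the mean of f under |u_a|^2, and these means always add
    up to m. The determinants evaluate K at every point, the diagonal included, whereas the rank
    hypothesis speaks almost everywhere; the expansion of K therefore has to be made pointwise. The
    radius 3/16 arises because f differs from each of its means by at most 2 s and e^y <= 1 + y +
    y^2 is applied for y <= 3/8. Integrability of X_f is not given: exponential moments of both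
    signs supply it, which is why they are centred at m and E X_f = m comes out as a consequence. *)

Lemma Re_addc (R : rcfType) (a b : R[i]) :
  complex.Re (a + b) = complex.Re a + complex.Re b.
Proof. by case: a; case: b. Qed.

Lemma Im_addc (R : rcfType) (a b : R[i]) :
  complex.Im (a + b) = complex.Im a + complex.Im b.
Proof. by case: a; case: b. Qed.

Lemma Re_mulc (R : rcfType) (a b : R[i]) : complex.Re (a * b) =
  complex.Re a * complex.Re b - complex.Im a * complex.Im b.
Proof. by case: a; case: b. Qed.

Lemma Im_mulc (R : rcfType) (a b : R[i]) : complex.Im (a * b) =
  complex.Re a * complex.Im b + complex.Im a * complex.Re b.
Proof. by case: a => a1 a2; case: b => b1 b2 /=; rewrite addrC. Qed.

Lemma Re_conjc (R : rcfType) (a : R[i]) : complex.Re (conjc a) = complex.Re a.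
Proof. by case: a. Qed.

Lemma Im_conjc (R : rcfType) (a : R[i]) : complex.Im (conjc a) = - complex.Im a.
Proof. by case: a. Qed.

Lemma conjcM (R : rcfType) (a b : R[i]) : conjc (a * b) = conjc a * conjc b.
Proof. exact: rmorphM. Qed.

Lemma complex_ext (R : rcfType) (a b : R[i]) :
  complex.Re a = complex.Re b -> complex.Im a = complex.Im b -> a = b.
Proof. by case: a => ? ?; case: b => ? ? /= -> ->. Qed.

Section cmeasurable.
Context {d : measure_display} {T : measurableType d} {R : realType}.
Implicit Types g h : T -> R[i].

Lemma cmeasurableD g h : cmeasurable g -> cmeasurable h ->
  cmeasurable (fun x => g x + h x).
Proof.
move=> [g1 g2] [h1 h2]; split.
  by under eq_fun do rewrite Re_addc; exact: measurable_funD.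
by under eq_fun do rewrite Im_addc; exact: measurable_funD.
Qed.

Lemma cmeasurableM g h : cmeasurable g -> cmeasurable h ->
  cmeasurable (fun x => g x * h x).
Proof.
move=> [g1 g2] [h1 h2]; split.
  by under eq_fun do rewrite Re_mulc; apply: measurable_funB; exact: measurable_funM.
by under eq_fun do rewrite Im_mulc; apply: measurable_funD; exact: measurable_funM.
Qed.

Lemma cmeasurable_conjc g : cmeasurable g -> cmeasurable (fun x => conjc (g x)).
Proof.
move=> [g1 g2]; split; first by under eq_fun do rewrite Re_conjc.
by under eq_fun do rewrite Im_conjc; exact: measurable_funN.
Qed.

Lemma cmeasurable_cst (c : R[i]) : cmeasurable (fun _ : T => c).
Proof. by split; exact: measurable_cst. Qed.

Lemma cmeasurable_real (f : T -> R) : measurable_fun setT f ->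
  cmeasurable (fun x => real_complex R (f x)).
Proof. by move=> mf; split => //=; exact: measurable_cst. Qed.

End cmeasurable.

Section cintegral.
Context {d : measure_display} {T : measurableType d} {R : realType}.
Variable mu : {measure set T -> \bar R}.
Implicit Types g h : T -> R[i].

Lemma cintegrable_measurable g : cintegrable mu g -> cmeasurable g.
Proof.
by move=> [/measurable_int/measurable_EFinP ? /measurable_int/measurable_EFinP].
Qed.

Lemma cintegral_eq g h : (forall x, g x = h x) ->
  cintegral mu g = cintegral mu h.
Proof. by move=> /funext ->. Qed.

Lemma cintegrableD g h : cintegrable mu g -> cintegrable mu h ->
  cintegrable mu (fun x => g x + h x).
Proof.
move=> [g1 g2] [h1 h2]; split.
  by under eq_fun do rewrite Re_addc EFinD; exact: integrableD.
by under eq_fun do rewrite Im_addc EFinD; exact: integrableD.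
Qed.

Lemma cintegralD g h : cintegrable mu g -> cintegrable mu h ->
  cintegral mu (fun x => g x + h x) = cintegral mu g + cintegral mu h.
Proof.
move=> [g1 g2] [h1 h2]; apply: complex_ext; rewrite /cintegral ?Re_addc ?Im_addc /=.
  by under eq_Rintegral do rewrite Re_addc; exact: RintegralD.
by under eq_Rintegral do rewrite Im_addc; exact: RintegralD.
Qed.

Lemma cintegrableZ (c : R[i]) g : cintegrable mu g ->
  cintegrable mu (fun x => c * g x).
Proof.
move=> [g1 g2]; split.
  under eq_fun do rewrite Re_mulc.
  exact (integrableB measurableT (integrableZl measurableT (complex.Re c) g1)
    (integrableZl measurableT (complex.Im c) g2)).
under eq_fun do rewrite Im_mulc.
exact (integrableD measurableT (integrableZl measurableT (complex.Re c) g2)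
  (integrableZl measurableT (complex.Im c) g1)).
Qed.

Lemma cintegralZ (c : R[i]) g : cintegrable mu g ->
  cintegral mu (fun x => c * g x) = c * cintegral mu g.
Proof.
move=> [g1 g2].
have Z (a : R) (f : T -> R) : mu.-integrable setT (EFin \o f) ->
    mu.-integrable setT (EFin \o (fun x => a * f x)).
  by move=> fi; exact (integrableZl measurableT a fi).
apply: complex_ext; rewrite ?Re_mulc ?Im_mulc /=.
  under eq_Rintegral do rewrite Re_mulc.
  by rewrite RintegralB ?RintegralZl//; exact: Z.
under eq_Rintegral do rewrite Im_mulc.
by rewrite RintegralD ?RintegralZl//; exact: Z.
Qed.

Lemma cintegrable0 : cintegrable mu (fun _ => 0).
Proof. by split; exact: integrable0. Qed.

Lemma cintegral0 : cintegral mu (fun _ => 0) = 0.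
Proof. by rewrite /cintegral /Rintegral !integral0. Qed.

Lemma cintegrable_sum (I : Type) (r : seq I) (g : I -> T -> R[i]) :
  (forall i, cintegrable mu (g i)) ->
  cintegrable mu (fun x => \sum_(i <- r) g i x).
Proof.
move=> ig; elim: r => [|i r IH].
  by under eq_fun do rewrite big_nil; exact: cintegrable0.
by under eq_fun do rewrite big_cons; exact: cintegrableD.
Qed.

Lemma cintegral_sum (I : Type) (r : seq I) (g : I -> T -> R[i]) :
  (forall i, cintegrable mu (g i)) ->
  cintegral mu (fun x => \sum_(i <- r) g i x) =
  \sum_(i <- r) cintegral mu (g i).
Proof.
move=> ig; elim: r => [|i r IH].
  by under eq_fun do rewrite big_nil; rewrite cintegral0 big_nil.
under eq_fun do rewrite big_cons.
by rewrite big_cons -IH cintegralD//; exact: cintegrable_sum.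
Qed.

Lemma cintegral_conjc g : cintegrable mu g ->
  cintegral mu (fun x => conjc (g x)) = conjc (cintegral mu g).
Proof.
move=> [g1 g2]; apply: complex_ext; rewrite /cintegral ?Re_conjc ?Im_conjc /=.
  by under eq_Rintegral do rewrite Re_conjc.
under eq_Rintegral do rewrite Im_conjc -mulN1r.
by rewrite RintegralZl// mulN1r.
Qed.

Lemma cintegral_ae_eq g h : cmeasurable g -> cmeasurable h ->
  {ae mu, forall x, g x = h x} -> cintegral mu g = cintegral mu h.
Proof.
move=> [g1 g2] [h1 h2] gh; apply: complex_ext => /=; congr fine.
  apply: ae_eq_integral => //; [exact/measurable_EFinP|exact/measurable_EFinP|].
  by apply: filterS gh => x -> _.
apply: ae_eq_integral => //; [exact/measurable_EFinP|exact/measurable_EFinP|].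
by apply: filterS gh => x -> _.
Qed.

Lemma cintegral_real (f : T -> R) :
  cintegral mu (fun x => real_complex R (f x)) = real_complex R (\int[mu]_x f x).
Proof.
by apply: complex_ext => //=; rewrite /Rintegral integral0.
Qed.

(** Convertible with the integrand in [L2], so that the second half of [L2 mu g] is directly the
    integrability of [sqnorm] along [g]. *)
Definition sqnorm (z : R[i]) : R := complex.Re z ^+ 2 + complex.Im z ^+ 2.

Lemma sqnorm_ge0 z : 0 <= sqnorm z.
Proof. by rewrite addr_ge0 ?sqr_ge0. Qed.

Lemma mulcJ_sqnorm (z : R[i]) : z * conjc z = real_complex R (sqnorm z).
Proof.
apply: complex_ext; rewrite ?Re_mulc ?Im_mulc ?Re_conjc ?Im_conjc /sqnorm /=; ring.
Qed.

Lemma sqnorm_eq0 z : sqnorm z = 0 -> z = 0.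
Proof.
move=> /eqP; rewrite paddr_eq0 ?sqr_ge0// !sqrf_eq0 => /andP[/eqP r0 /eqP i0].
exact: complex_ext.
Qed.

Lemma measurable_sqnorm g : cmeasurable g ->
  measurable_fun setT (fun x => sqnorm (g x)).
Proof.
by move=> [g1 g2]; apply: measurable_funD; exact: measurable_funX.
Qed.

Lemma L2_mul (phi : T -> R) g h : measurable_fun setT phi -> bounded_fun phi ->
  L2 mu g -> L2 mu h ->
  cintegrable mu (fun x => real_complex R (phi x) * (g x * conjc (h x))).
Proof.
move=> mphi [M [Mreal Mphi]] [mg ig] [mh ih].
have {Mphi}[C C0 phiC] : exists2 C, 0 <= C & forall x, `|phi x| <= C.
  exists (`|M| + 1); first by rewrite addr_ge0.
  by move=> x; apply: Mphi => //; rewrite (le_lt_trans (ler_norm _))// ltrDl.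
have mF : cmeasurable (fun x => real_complex R (phi x) * (g x * conjc (h x))).
  apply: cmeasurableM; first exact: cmeasurable_real.
  by apply: cmeasurableM => //; exact: cmeasurable_conjc.
have iB : mu.-integrable setT
    (fun x => (C * (sqnorm (g x) + sqnorm (h x)))%:E).
  exact (integrableZl measurableT _ (integrableD measurableT ig ih)).
(* Real and imaginary parts of g conj(h) both have the shape a c + b e, the latter with c = - Im h
   and e = Re h. *)
have key (a b c e : R) : `|a * c + b * e| <= (a^+2 + b^+2) + (c^+2 + e^+2).
  rewrite ler_norml; have := (sqr_ge0 (a - c), sqr_ge0 (b - e), sqr_ge0 (a + c),
    sqr_ge0 (b + e), sqr_ge0 a, sqr_ge0 b, sqr_ge0 c, sqr_ge0 e).
  by rewrite !expr2 => -[[[[[[[]]]]]]] *; apply/andP; split; lra.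
split.
  apply: (le_integrable _ _ _ iB) => //; first exact/measurable_EFinP/mF.1.
  move=> x _; rewrite !abse_EFin lee_fin (@ger0_norm _ (C * _)); last first.
    by rewrite mulr_ge0// addr_ge0// sqnorm_ge0.
  rewrite !(Re_mulc, Im_mulc, Re_conjc, Im_conjc) /= !mul0r subr0 normrM ler_pM// mulrN opprK.
  exact: key.
apply: (le_integrable _ _ _ iB) => //; first exact/measurable_EFinP/mF.2.
move=> x _; rewrite !abse_EFin lee_fin (@ger0_norm _ (C * _)); last first.
  by rewrite mulr_ge0// addr_ge0// sqnorm_ge0.
rewrite !(Re_mulc, Im_mulc, Re_conjc, Im_conjc) /= !mul0r addr0 normrM ler_pM//.
apply: le_trans (key _ _ _ _) _.
by rewrite sqrrN /sqnorm lerD2l addrC.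
Qed.

Lemma L2_mul1 g h : L2 mu g -> L2 mu h ->
  cintegrable mu (fun x => g x * conjc (h x)).
Proof.
move=> Lg Lh; rewrite (_ : (fun _ => _) =
    (fun x => real_complex R (cst 1 x) * (g x * conjc (h x)))); last first.
  by apply/funext => x; rewrite /cst rmorph1 mul1r.
apply: L2_mul => //; exists 1; split => // x x1 y _ /=.
by rewrite normr1; exact: ltW.
Qed.

Lemma L2_conjc g : L2 mu g -> L2 mu (fun x => conjc (g x)).
Proof.
move=> [mg ig]; split; first exact: cmeasurable_conjc.
by under eq_fun do rewrite Re_conjc Im_conjc sqrrN.
Qed.

Lemma L2Z (c : R[i]) g : L2 mu g -> L2 mu (fun x => c * g x).
Proof.
move=> [mg ig]; split; first by apply: cmeasurableM => //; exact: cmeasurable_cst.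
rewrite (_ : (fun _ => _) = (fun x => (sqnorm c)%:E * (sqnorm (g x))%:E)%E).
  exact: integrableZl.
apply/funext => x; rewrite -EFinM Re_mulc Im_mulc /sqnorm; congr EFin; ring.
Qed.

Lemma L2D g h : L2 mu g -> L2 mu h -> L2 mu (fun x => g x + h x).
Proof.
move=> [mg ig] [mh ih]; have mgh := cmeasurableD mg mh; split => //.
have iB : mu.-integrable setT
    (fun x => (2 * (sqnorm (g x) + sqnorm (h x)))%:E).
  exact (integrableZl measurableT _ (integrableD measurableT ig ih)).
apply: (le_integrable _ _ _ iB) => //.
  by apply/measurable_EFinP; exact: measurable_sqnorm.
move=> x _; rewrite !abse_EFin lee_fin -!/(sqnorm _).
rewrite !ger0_norm ?mulr_ge0 ?(addr_ge0 (sqnorm_ge0 _)) ?sqnorm_ge0// /sqnorm Re_addc Im_addc.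
have := (sqr_ge0 (complex.Re (g x) - complex.Re (h x)),
  sqr_ge0 (complex.Im (g x) - complex.Im (h x))).
by rewrite !expr2 => -[*]; lra.
Qed.

Lemma L2_0 : L2 mu (fun _ => 0).
Proof.
split; first exact: cmeasurable_cst.
by under eq_fun do rewrite /= expr0n addr0; exact: integrable0.
Qed.

Lemma L2_sum (I : Type) (r : seq I) (g : I -> T -> R[i]) :
  (forall i, L2 mu (g i)) -> L2 mu (fun x => \sum_(i <- r) g i x).
Proof.
move=> ig; elim: r => [|i r IH].
  by under eq_fun do rewrite big_nil; exact: L2_0.
by under eq_fun do rewrite big_cons; exact: L2D.
Qed.

End cintegral.

(** * Sums of iterated integrals of determinants *)

Section iterated_cintegral.
Context {d : measure_display} {T : measurableType d} {R : realType}.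
Variable mu : {measure set T -> \bar R}.

(* A relation rather than a function: it records the integrability at every
   stage that makes iterated integration linear. *)
Fixpoint is_iterated_cintegral (k : nat) :
    (k.-tuple T -> R[i]) -> R[i] -> Prop :=
  match k with
  | 0 => fun F v => F [tuple] = v
  | k'.+1 => fun F v => exists I : T -> R[i],
      [/\ cintegrable mu I, cintegral mu I = v &
        forall x, is_iterated_cintegral
          (fun t : k'.-tuple T => F [tuple of x :: t]) (I x)]
  end.

Lemma iterated_integral_Re k (F : k.-tuple T -> R[i]) v :
  is_iterated_cintegral F v ->
  iterated_integral mu (fun t => complex.Re (F t)) = complex.Re v.
Proof.
elim: k F v => [|k IH] F v /=; first by move=> ->.
move=> [I [iI <- HI]]; apply: eq_Rintegral => x _.
exact: (IH (fun t : k.-tuple T => F [tuple of x :: t])).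
Qed.

Lemma is_iterated_cintegralZ (c : R[i]) k (F : k.-tuple T -> R[i]) v :
  is_iterated_cintegral F v -> is_iterated_cintegral (fun t => c * F t) (c * v).
Proof.
elim: k F v => [|k IH] F v /=; first by move=> ->.
move=> [I [iI <- HI]]; exists (fun x => c * I x); split.
- exact: cintegrableZ.
- exact: cintegralZ.
- by move=> x; exact: (IH (fun t : k.-tuple T => F [tuple of x :: t])).
Qed.

Lemma is_iterated_cintegralD k (F G : k.-tuple T -> R[i]) v w :
  is_iterated_cintegral F v -> is_iterated_cintegral G w ->
  is_iterated_cintegral (fun t => F t + G t) (v + w).
Proof.
elim: k F G v w => [|k IH] F G v w /=; first by move=> -> ->.
move=> [I [iI <- HI]] [J [iJ <- HJ]]; exists (fun x => I x + J x); split.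
- exact: cintegrableD.
- exact: cintegralD.
- by move=> x; exact: (IH (fun t : k.-tuple T => F [tuple of x :: t])
    (fun t : k.-tuple T => G [tuple of x :: t])).
Qed.

Lemma is_iterated_cintegral0 k :
  is_iterated_cintegral (fun _ : k.-tuple T => 0) 0.
Proof.
elim: k => //= k IH; exists (fun=> 0); split => //.
- exact: cintegrable0.
- exact: cintegral0.
Qed.

Lemma is_iterated_cintegral_sum k (I : Type) (r : seq I)
    (F : I -> k.-tuple T -> R[i]) (v : I -> R[i]) :
  (forall i, is_iterated_cintegral (F i) (v i)) ->
  is_iterated_cintegral (fun t => \sum_(i <- r) F i t) (\sum_(i <- r) v i).
Proof.
move=> FI; elim: r => [|i r IH].
  under eq_fun do rewrite big_nil.
  by rewrite big_nil; exact: is_iterated_cintegral0.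
under eq_fun do rewrite big_cons.
by rewrite big_cons; exact: is_iterated_cintegralD.
Qed.

(** With separated variables each stage of the iteration only pulls out a constant. The expanded
    determinants below are sums of such products. *)
Lemma is_iterated_cintegral_prod k (g : 'I_k -> T -> R[i]) :
  (forall i, cintegrable mu (g i)) ->
  is_iterated_cintegral (fun t => \prod_(i < k) g i (tnth t i))
    (\prod_(i < k) cintegral mu (g i)).
Proof.
elim: k g => [|k IH] g ig /=; first by rewrite !big_ord0.
exists (fun x => g ord0 x * \prod_(i < k) cintegral mu (g (lift ord0 i))).
split.
- by under eq_fun do rewrite mulrC; exact: cintegrableZ.
- under eq_fun do rewrite mulrC.
  by rewrite cintegralZ// mulrC big_ord_recl.
- move=> x.
  have -> : (fun t : k.-tuple T =>
        \prod_(i < k.+1) g i (tnth [tuple of x :: t] i)) =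
      (fun t => g ord0 x * \prod_(i < k) g (lift ord0 i) (tnth t i)).
    apply/funext => t; rewrite big_ord_recl tnth0; congr (_ * _).
    by apply: eq_bigr => i _; rewrite tnthS.
  by apply: is_iterated_cintegralZ; apply: IH.
Qed.

End iterated_cintegral.

(** Injections are grouped by their image: each subset with k elements is the image of k! of
    them. *)
Lemma sum_inj_ffun (A : comPzRingType) (N k : nat) (p : 'I_N -> A) :
  \sum_(a : {ffun 'I_k -> 'I_N} | injectiveb a) \prod_(i < k) p (a i) =
  k`!%:R * \sum_(S : {set 'I_N} | #|S| == k) \prod_(j in S) p j.
Proof.
rewrite (partition_big (fun a : {ffun 'I_k -> 'I_N} => [set a i | i : 'I_k]%SET)
  (fun S : {set 'I_N} => #|S| == k)) /=; last first.
  by move=> a /injectiveP inja; rewrite card_imset// card_ord.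
rewrite mulr_sumr; apply: eq_bigr => S /eqP cardS.
transitivity (\sum_(a : {ffun 'I_k -> 'I_N} |
    injectiveb a && ([set a i | i : 'I_k]%SET == S)) \prod_(j in S) p j).
  apply: eq_bigr => a /andP[/injectiveP inja /eqP <-].
  by rewrite big_imset //=; move=> x y _ _; exact: inja.
rewrite sumr_const mulr_natl; congr (_ *+ _).
(* An injection into S is onto S, both sides having k elements, so it suffices to count injections
   into S. *)
transitivity #|[set a : {ffun 'I_k -> 'I_N} in ffun_on (mem S) | injectiveb a]%SET|.
  rewrite cardsE; apply: eq_card => a; rewrite !unfold_in andbC [RHS]andbC [LHS]andbC.
  apply: andb_id2l => /injectiveP inja.
  apply/idP/idP => [/eqP <-|/ffun_onP aS].
    by apply/ffun_onP => i; exact: imset_f.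
  rewrite eqEcard card_imset// card_ord cardS leqnn andbT.
  by apply/fintype.subsetP => _ /imsetP[i _ ->]; exact: aS.
by rewrite card_inj_ffuns_on card_ord cardS ffactnn.
Qed.

(** An injective map gives the identity matrix, any other map a repeated row. This removes the
    non-injective index maps from the correlation expansion. *)
Lemma det_ffun_delta (A : comPzRingType) (I : finType) (k : nat)
    (a : {ffun 'I_k -> I}) :
  \det (\matrix_(i < k, j < k) ((a i == a j)%:R : A)) = (injectiveb a)%:R.
Proof.
have [/injectiveP inja|/injectivePn[i [j ij aij]]] := boolP (injectiveb a).
  rewrite -[RHS](@det1 A k); congr (\det _).
  by apply/matrixP => i j; rewrite !mxE (inj_eq inja).
by apply: (determinant_alternate ij) => l; rewrite !mxE aij.
Qed.

Lemma sum_subsets_card (A : comPzRingType) (N : nat) (p : 'I_N -> A) :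
  \sum_(k < N.+1) \sum_(S : {set 'I_N} | #|S| == k) \prod_(j in S) p j =
  \prod_(i < N) (1 + p i).
Proof.
transitivity (\sum_(S : {set 'I_N}) \prod_(j in S) p j).
  (* The default value of [inord] is never taken, since #|S| <= N. *)
  rewrite (partition_big (fun S : {set 'I_N} => inord #|S| : 'I_N.+1) predT)//=.
  apply: eq_bigr => k _; apply: eq_bigl => S.
  rewrite -val_eqE /= inordK// ltnS.
  by rewrite -[X in (_ <= X)%N]card_ord max_card.
under [RHS]eq_bigr do rewrite addrC.
rewrite bigA_distr /=; apply: eq_bigr => S _.
by rewrite [RHS](big_mkcond) /= [LHS]big_mkcond.
Qed.

Section fredholm.
Context {d : measure_display} {T : measurableType d} {R : realType}.
Variable mu : {measure set T -> \bar R}.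
Variables (N : nat) (u : 'I_N -> T -> R[i]) (K : T -> T -> R[i]).
Variables (phi : T -> R) (p : 'I_N -> R).
Hypothesis KE : forall x z, K x z = \sum_(a < N) u a x * conjc (u a z).
Hypothesis iu : forall a b,
  cintegrable mu (fun x => real_complex R (phi x) * (u a x * conjc (u b x))).
Hypothesis phi_diag : forall a b,
  cintegral mu (fun x => real_complex R (phi x) * (u a x * conjc (u b x))) =
  real_complex R (p a) * (a == b)%:R.

(** Expanding every entry of the matrix in the u_a gives a sum over index maps a and permutations s
    of products in separated variables. After integration the sum over s is the product of the p_(a
    i) times the determinant of the matrix of delta_(a i, a j). *)
Lemma correlation_iterated_integral k :
  iterated_integral mu (fun t : k.-tuple T =>
    (\prod_(i < k) phi (tnth t i)) *
    complex.Re (\det (\matrix_(i < k, j < k) K (tnth t i) (tnth t j)))) =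
  k`!%:R * \sum_(S : {set 'I_N} | #|S| == k) \prod_(j in S) p j.
Proof.
pose g (a b : 'I_N) (x : T) : R[i] :=
  real_complex R (phi x) * (u a x * conjc (u b x)).
have FE (t : k.-tuple T) :
    real_complex R (\prod_(i < k) phi (tnth t i)) *
    \det (\matrix_(i < k, j < k) K (tnth t i) (tnth t j)) =
    \sum_(a : {ffun 'I_k -> 'I_N}) \sum_(s : 'S_k) (-1) ^+ s *
      \prod_(i < k) g (a i) (a (s i)) (tnth t i).
  rewrite exchange_big /= -det_tr /determinant mulr_sumr; apply: eq_bigr => s _.
  rewrite rmorph_prod /=.
  under [X in _ * (_ * X)]eq_bigr do rewrite !mxE KE.
  rewrite bigA_distr_bigA /= mulr_sumr mulr_sumr.
  (* Because of the transposition the i-th factor is K(t_(s i), t_i). Replacing a by a o s and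
     permuting the first factors puts u_(a i) and conj(u_(a (s i))) at the same variable t_i. *)
  rewrite (reindex (fun a : {ffun 'I_k -> 'I_N} => [ffun i => a (s i)])) /=; last first.
    exists (fun a : {ffun 'I_k -> 'I_N} => [ffun i => a ((s^-1)%g i)]) => a _ /=;
    by apply/ffunP => i; rewrite !ffunE ?permK ?permKV.
  apply: eq_bigr => a _; rewrite mulrCA; congr (_ * _).
  rewrite /g [RHS]big_split /=; congr (_ * _).
  under eq_bigr do rewrite ffunE.
  rewrite [LHS]big_split [RHS]big_split /=; congr (_ * _).
  by rewrite [RHS](reindex_inj (@perm_inj _ s)).
pose v : R[i] := \sum_(a : {ffun 'I_k -> 'I_N}) \sum_(s : 'S_k) (-1) ^+ s *
      \prod_(i < k) cintegral mu (g (a i) (a (s i))).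
have Fv : is_iterated_cintegral mu (fun t : k.-tuple T =>
    real_complex R (\prod_(i < k) phi (tnth t i)) *
    \det (\matrix_(i < k, j < k) K (tnth t i) (tnth t j))) v.
  rewrite (funext FE); apply: is_iterated_cintegral_sum => a.
  apply: is_iterated_cintegral_sum => s; apply: is_iterated_cintegralZ.
  exact: (is_iterated_cintegral_prod (fun i => iu (a i) (a (s i)))).
have := iterated_integral_Re Fv.
under [X in iterated_integral _ X = _ -> _]eq_fun do rewrite Re_mulc /= mul0r subr0.
move=> ->.
suff -> : v = real_complex R
  (k`!%:R * \sum_(S : {set 'I_N} | #|S| == k) \prod_(j in S) p j) by [].
rewrite -sum_inj_ffun rmorph_sum /= [RHS]big_mkcond /=; apply: eq_bigr => a _.
transitivity (real_complex R (\prod_(i < k) p (a i)) * (injectiveb a)%:R);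
  last by case: (injectiveb a); rewrite ?mulr1 ?mulr0.
rewrite -det_ffun_delta /determinant mulr_sumr; apply: eq_bigr => s _.
rewrite mulrCA; congr (_ * _); rewrite rmorph_prod -big_split /=.
by apply: eq_bigr => i _; rewrite /g phi_diag mxE.
Qed.

Lemma correlation_sum :
  \sum_(k < N.+1) (k`!%:R)^-1 * iterated_integral mu (fun t : k.-tuple T =>
    (\prod_(i < k) phi (tnth t i)) *
    complex.Re (\det (\matrix_(i < k, j < k) K (tnth t i) (tnth t j)))) =
  \prod_(i < N) (1 + p i).
Proof.
rewrite -sum_subsets_card; apply: eq_bigr => k _.
rewrite correlation_iterated_integral mulKf//.
Qed.

End fredholm.

(** * Diagonalization of weighted inner products *)

(** The spectral theorem, written as sums to match the sesquilinear expansion of inner products.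
    Orthonormality of rows will preserve norms, that of columns will preserve the kernel; e can be
    real-valued because A is Hermitian. *)
Lemma hermitian_diagonalization (R : realType) (n : nat) (A : 'M[R[i]]_n) :
  (forall i j, A j i = conjc (A i j)) ->
  exists (P : 'M[R[i]]_n) (e : 'I_n -> R), [/\
    forall i j, \sum_k P i k * conjc (P j k) = (i == j)%:R,
    forall i j, \sum_k conjc (P k i) * P k j = (i == j)%:R &
    forall i j, \sum_k \sum_l P i k * conjc (P j l) * A k l =
      real_complex R (e i) * (i == j)%:R].
Proof.
move=> AH.
have hA : A \is hermsymmx.
  apply/is_hermitianmxP; rewrite expr0 scale1r.
  by apply/matrixP => i j; rewrite !mxE AH.
have PU := spectral_unitarymx A; set P := spectralmx A in PU *.
have /orthomx_spectralP := hermitian_normalmx hA; rewrite -/P => PA.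
have /mxOverP Dreal := hermitian_spectral_diag_real hA.
set D := spectral_diag A in PA Dreal *.
have PP : P *m (P ^t*)%sesqui = 1%:M by exact/unitarymxP.
have PP' : (P ^t*)%sesqui *m P = 1%:M by exact: mulmx1C.
rewrite (invmx_unitary PU) in PA.
exists P, (fun i => complex.Re (D 0 i)); split => i j.
- have := congr1 (fun M : 'M[R[i]]_n => M i j) PP; rewrite !mxE => <-.
  by apply: eq_bigr => k _; rewrite !mxE.
- have := congr1 (fun M : 'M[R[i]]_n => M i j) PP'; rewrite !mxE => <-.
  by apply: eq_bigr => k _; rewrite !mxE.
- have : (P *m A *m (P ^t*)%sesqui) i j = diag_mx D i j.
    by rewrite PA !mulmxA PP mul1mx -mulmxA PP mulmx1.
  rewrite mxE [RHS]mxE => DE.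
  rewrite (RRe_real (Dreal _ _)) mulr_natr -[RHS]DE exchange_big /=.
  apply: eq_bigr => l _; rewrite !mxE mulr_suml; apply: eq_bigr => k _.
  by rewrite -!mulrA; congr (_ * _); rewrite mulrC.
Qed.

Section orthonormal.
Context {d : measure_display} {T : measurableType d} {R : realType}.
Variable mu : {measure set T -> \bar R}.
Variable N : nat.
Implicit Types (u w : 'I_N -> T -> R[i]) (phi : T -> R).

Definition weighted_inner phi (g h : T -> R[i]) : R[i] :=
  cintegral mu (fun x => real_complex R (phi x) * (g x * conjc (h x))).

Definition combination (P : 'M[R[i]]_N) w : 'I_N -> T -> R[i] :=
  fun i x => \sum_k P i k * w k x.

Lemma L2_combination (P : 'M[R[i]]_N) w : (forall i, L2 mu (w i)) ->
  forall i, L2 mu (combination P w i).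
Proof. by move=> Lw i; apply: L2_sum => k; exact: L2Z. Qed.

Lemma weighted_inner_conjc phi g h : measurable_fun setT phi -> bounded_fun phi ->
  L2 mu g -> L2 mu h -> weighted_inner phi h g = conjc (weighted_inner phi g h).
Proof.
move=> mphi bphi Lg Lh; rewrite /weighted_inner -cintegral_conjc; last exact: L2_mul.
by apply: cintegral_eq => x; rewrite !conjcM conjcK conjc_real [in LHS](mulrC (h x)).
Qed.

Lemma weighted_inner_combination phi (P : 'M[R[i]]_N) w :
  measurable_fun setT phi -> bounded_fun phi -> (forall i, L2 mu (w i)) ->
  forall i j, weighted_inner phi (combination P w i) (combination P w j) =
    \sum_k \sum_l P i k * conjc (P j l) * weighted_inner phi (w k) (w l).
Proof.
move=> mphi bphi Lw i j.
have -> : weighted_inner phi (combination P w i) (combination P w j) =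
    cintegral mu (fun x => \sum_k \sum_l P i k * conjc (P j l) *
       (real_complex R (phi x) * (w k x * conjc (w l x)))).
  apply: cintegral_eq => x; rewrite /combination rmorph_sum /= mulr_suml mulr_sumr.
  apply: eq_bigr => k _; rewrite !mulr_sumr; apply: eq_bigr => l _.
  by rewrite conjcM; ring.
have iw k l : cintegrable mu (fun x => P i k * conjc (P j l) *
       (real_complex R (phi x) * (w k x * conjc (w l x)))).
  by apply: cintegrableZ; exact: L2_mul.
rewrite cintegral_sum; last by move=> k; exact: cintegrable_sum.
apply: eq_bigr => k _; rewrite cintegral_sum//; apply: eq_bigr => l _.
by rewrite cintegralZ//; exact: L2_mul.
Qed.

(** The Gram matrix of w for a real weight is Hermitian. This is used with weight 1 to orthogonalize
    a basis of the range, then with phi = e^(t f) - 1 to adapt an orthonormal basis to f and t. *)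
Lemma combination_diagonalization phi w :
  measurable_fun setT phi -> bounded_fun phi -> (forall i, L2 mu (w i)) ->
  exists (P : 'M[R[i]]_N) (e : 'I_N -> R), [/\
    forall i j, \sum_k P i k * conjc (P j k) = (i == j)%:R,
    forall i j, \sum_k conjc (P k i) * P k j = (i == j)%:R &
    forall i j, weighted_inner phi (combination P w i) (combination P w j) =
      real_complex R (e i) * (i == j)%:R].
Proof.
move=> mphi bphi Lw.
have [|P [e [P1 P2 P3]]] := @hermitian_diagonalization R N
    (\matrix_(i, j) weighted_inner phi (w i) (w j)).
  by move=> i j; rewrite !mxE; exact: weighted_inner_conjc.
exists P, e; split => // i j; rewrite weighted_inner_combination// -P3.
by apply: eq_bigr => k _; apply: eq_bigr => l _; rewrite mxE.
Qed.

Lemma combination_kernel (P : 'M[R[i]]_N) u :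
  (forall i j, \sum_k conjc (P k i) * P k j = (i == j)%:R) ->
  forall x z, \sum_a combination P u a x * conjc (combination P u a z) =
    \sum_a u a x * conjc (u a z).
Proof.
move=> P2 x z.
transitivity (\sum_k \sum_l (\sum_a conjc (P a l) * P a k) * (u k x * conjc (u l z))).
  rewrite /combination; under eq_bigr do rewrite rmorph_sum /= mulr_suml.
  rewrite exchange_big /=; apply: eq_bigr => k _.
  under eq_bigr do rewrite mulr_sumr.
  rewrite exchange_big /=; apply: eq_bigr => l _.
  by rewrite mulr_suml; apply: eq_bigr => a _; rewrite conjcM; ring.
apply: eq_bigr => k _; rewrite (bigD1 k)//= P2 eqxx mul1r big1 ?addr0// => l lk.
by rewrite P2 (negbTE lk) mul0r.
Qed.

End orthonormal.

(** * Orthonormal expansion of a projection kernel *)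

Section projection_kernel.
Context {d : measure_display} {T : measurableType d} {R : realType}.
Variable mu : {measure set T -> \bar R}.
Variables (K : T -> T -> R[i]) (N : nat).
Hypothesis pK : projection_kernel mu K N.
Local Notation op := (integral_operator mu K).

(** The diagonal case of [pk_integrable] and Hermitian symmetry bound the integral of |K(x, y)|^2
    for every x, not just almost every x. *)
Lemma kernel_row_L2 x : L2 mu (K x).
Proof.
have [m1 m2] := pk_measurable pK.
have mKx : cmeasurable (K x).
  by split; [exact: measurable_fun_pair2 m1|exact: measurable_fun_pair2 m2].
split=> //; have [+ _] := pk_integrable pK x x.
by under eq_fun do rewrite [K _ x](pk_hermitian pK) mulcJ_sqnorm /=.
Qed.

Lemma kernel_col_L2 z : L2 mu (fun y => K y z).
Proof.
under eq_fun do rewrite (pk_hermitian pK).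
exact: L2_conjc (kernel_row_L2 z).
Qed.

Lemma kernel_row_integrable x g : L2 mu g -> cintegrable mu (fun y => K x y * g y).
Proof.
move=> /L2_conjc /(L2_mul1 (kernel_row_L2 x)).
by under eq_fun do rewrite conjcK.
Qed.

Lemma op_sum (w : 'I_N -> T -> R[i]) (c : 'I_N -> R[i]) x :
  (forall i, L2 mu (w i)) ->
  op (fun y => \sum_i c i * w i y) x = \sum_i c i * op (w i) x.
Proof.
move=> Lw; rewrite /integral_operator.
under eq_fun do rewrite mulr_sumr.
rewrite cintegral_sum; last first.
  by move=> i; apply: kernel_row_integrable; exact: L2Z.
apply: eq_bigr => i _; rewrite -cintegralZ; last exact: kernel_row_integrable.
by apply: cintegral_eq => y; rewrite mulrCA.
Qed.

(** The integral ignores null sets, so applying the operator upgrades an almost everywhere equality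
    to one at every point. *)
Lemma op_ae_eq g h : L2 mu g -> L2 mu h -> {ae mu, forall x, g x = h x} ->
  forall x, op g x = op h x.
Proof.
move=> Lg Lh gh x; apply: cintegral_ae_eq.
- exact: cintegrable_measurable (kernel_row_integrable x Lg).
- exact: cintegrable_measurable (kernel_row_integrable x Lh).
- by apply: filterS gh => y ->.
Qed.

(* The expansion of K(., z) in the basis of the range, given almost everywhere,
   becomes pointwise after applying the operator, which fixes K(., z). *)
Lemma kernel_range_basis : exists (w : 'I_N -> T -> R[i]) (c : 'I_N -> T -> R[i]), [/\
  forall i, L2 mu (w i),
  forall i x, op (w i) x = w i x,
  forall a : 'I_N -> R[i],
    {ae mu, forall x, \sum_i a i * w i x = 0} -> forall i, a i = 0 &
  forall x z, K x z = \sum_i c i z * w i x].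
Proof.
have [e [eE efree espan]] := pk_rank pK.
have Le i : L2 mu (e i).
  by have [h Lh ->] := eE i; exact: (pk_L2 pK Lh).2.
have we i : {ae mu, forall x, op (e i) x = e i x}.
  by have [h Lh ->] := eE i; exact: pk_idempotent pK _ Lh.
have Lw i : L2 mu (op (e i)) := (pk_L2 pK (Le i)).2.
have cP z : exists c : 'I_N -> R[i],
    {ae mu, forall x, K x z = \sum_i c i * e i x}.
  have [c Hc] := espan _ (kernel_col_L2 z); exists c.
  by apply: filterS Hc => x <-; rewrite -(pk_reproducing pK).
have [c Hc] := choice cP.
exists (fun i => op (e i)), (fun i z => c z i); split => //.
- by move=> i x; apply: op_ae_eq.
- move=> a Ha; apply: efree.
  have wea : {ae mu, forall x, forall i, op (e i) x = e i x}.
    exact: (filter_forall (ae_filter_ringOfSetsType mu) we).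
  apply: filterS2 wea Ha => x wex ax; rewrite -[RHS]ax.
  by apply: eq_bigr => i _; rewrite wex.
- move=> x z; rewrite -op_sum// -[LHS](pk_reproducing pK).
  apply: (op_ae_eq (kernel_col_L2 z) _ (Hc z)).
  by apply: L2_sum => i; exact: L2Z.
Qed.

(** Diagonalizing the Gram matrix of the basis w and rescaling gives an orthonormal basis of the
    range, in which the coefficients of K(., z) are found by pairing. *)
Lemma kernel_orthonormal_expansion : exists u : 'I_N -> T -> R[i], [/\
  forall i, L2 mu (u i),
  forall i j, cintegral mu (fun x => u i x * conjc (u j x)) = (i == j)%:R &
  forall x z, K x z = \sum_a u a x * conjc (u a z)].
Proof.
have [w [c [Lw opw wfree KE]]] := kernel_range_basis.
have bphi : bounded_fun (cst 1 : T -> R).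
  by exists 1; split => // x x1 y _ /=; rewrite normr1; exact: ltW.
have [P [e [P1 P2 Pe]]] :=
  combination_diagonalization (@measurable_cst _ _ _ _ _ _) bphi Lw.
set v := combination P w in Pe.
have Lv i : L2 mu (v i) by exact: L2_combination.
have vE i j : cintegral mu (fun x => v i x * conjc (v j x)) =
    real_complex R (e i) * (i == j)%:R.
  by rewrite -Pe; apply: cintegral_eq => x; rewrite /cst rmorph1 mul1r.
have eE i : e i = \int[mu]_x sqnorm (v i x).
  apply: (@complexI R); rewrite -cintegral_real -[LHS]mulr1.
  have := vE i i; rewrite eqxx => <-.
  by apply: cintegral_eq => x; rewrite mulcJ_sqnorm.
(* A zero eigenvalue would make v_i vanish almost everywhere; by independence of w the i-th row of P
   would be zero, although it is a unit vector. *)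
have e_gt0 i : 0 < e i.
  rewrite lt_def; apply/andP; split; last first.
    by rewrite eE; apply: Rintegral_ge0 => x _; exact: sqnorm_ge0.
  apply/eqP => ei0.
  have vi0 : {ae mu, forall x, v i x = 0}.
    have [mv iv] := Lv i.
    have : (\int[mu]_x (sqnorm (v i x))%:E)%E = 0%E.
      by rewrite -[LHS]fineK ?integrable_fin_num// -/(Rintegral _ _ _) -eE ei0.
    under eq_integral do rewrite -(ger0_norm (sqnorm_ge0 (v i _))) -abse_EFin.
    move/ae_eq_integral_abs => /(_ measurableT) H.
    have /H {H} : measurable_fun setT (fun x => (sqnorm (v i x))%:E).
      by apply/measurable_EFinP; exact: measurable_sqnorm.
    by apply: filterS => x /(_ I) [] /sqnorm_eq0.
  have Pi0 := wfree _ vi0.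
  have := P1 i i; rewrite eqxx big1 => [/eqP|k _]; last by rewrite Pi0 mul0r.
  by rewrite eq_sym oner_eq0.
pose s i : R[i] := real_complex R (Num.sqrt (e i)).
have sE i : s i * s i = real_complex R (e i).
  by rewrite /s -rmorphM -expr2 sqr_sqrtr// ltW.
have s0 i : s i != 0.
  apply/eqP => /(congr1 (fun z => z * z)); rewrite sE mul0r => /(@complexI R)/eqP.
  by rewrite gt_eqF.
have sJ i : conjc (s i)^-1 = (s i)^-1 by rewrite conjc_inv conjc_real.
pose u i x := (s i)^-1 * v i x.
have Lu i : L2 mu (u i) by exact: L2Z.
have uE i j : cintegral mu (fun x => u i x * conjc (u j x)) = (i == j)%:R.
  transitivity ((s i)^-1 * (s j)^-1 * cintegral mu (fun x => v i x * conjc (v j x))).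
    rewrite -cintegralZ; last exact: L2_mul1.
    by apply: cintegral_eq => x; rewrite /u conjcM sJ mulrACA.
  rewrite vE; have [<-|_] := eqVneq i j; last by rewrite !mulr0.
  by rewrite mulr1 -sE mulrACA mulVf// mulr1.
have opu i x : op (u i) x = u i x.
  rewrite /integral_operator /u; under eq_fun do rewrite mulrCA.
  rewrite cintegralZ; last exact: kernel_row_integrable.
  congr (_ * _); rewrite -/(integral_operator mu K (v i) x) /v /combination.
  by rewrite op_sum//; apply: eq_bigr => k _; rewrite opw.
(* The coefficients after inverting P by its adjoint; the factor s_i undoes the scaling in u_i. *)
pose b i z := s i * \sum_k c k z * conjc (P i k).
have KuE x z : K x z = \sum_i b i z * u i x.
  rewrite KE; transitivity (\sum_k \sum_l c k z * w l x * \sum_i conjc (P i k) * P i l).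
    apply: eq_bigr => k _; rewrite (bigD1 k)//= P2 eqxx mulr1 big1 ?addr0// => l lk.
    by rewrite P2 eq_sym (negbTE lk) mulr0.
  transitivity (\sum_i \sum_k \sum_l c k z * conjc (P i k) * (P i l * w l x)).
    rewrite [RHS]exchange_big; apply: eq_bigr => k _.
    rewrite [RHS]exchange_big; apply: eq_bigr => l _.
    by rewrite mulr_sumr; apply: eq_bigr => i _; ring.
  apply: eq_bigr => i _; rewrite /b /u /v /combination [RHS]mulrACA.
  rewrite mulfV// mul1r mulr_suml; apply: eq_bigr => k _.
  by rewrite mulr_sumr.
(* Pairing K(., z) with u_i gives b_i(z) by orthonormality, and conj(u_i(z)) by Hermitian symmetry,
   because the operator fixes u_i. *)
have bE i z : b i z = conjc (u i z).
  have : cintegral mu (fun x => K x z * conjc (u i x)) = b i z.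
    under eq_fun do rewrite KuE mulr_suml.
    under eq_fun do under eq_bigr do rewrite -mulrA.
    rewrite cintegral_sum; last by move=> k; apply: cintegrableZ; exact: L2_mul1.
    rewrite (bigD1 i)//= big1 => [|k ki]; last first.
      rewrite cintegralZ; last exact: L2_mul1.
      by rewrite uE (negbTE ki) mulr0.
    rewrite cintegralZ; last exact: L2_mul1.
    by rewrite uE eqxx mulr1 addr0.
  move=> <-; rewrite -opu /integral_operator -cintegral_conjc; last first.
    exact: kernel_row_integrable.
  by apply: cintegral_eq => x; rewrite [RHS]conjcM -(pk_hermitian pK).
exists u; split => // x z; rewrite KuE; apply: eq_bigr => i _.
by rewrite bE mulrC.
Qed.

End projection_kernel.

(** * Laplace transform of a linear statistic *)

(** Squaring 1 - y/2 <= e^(-y/2) bounds e^(-y) below by (1 - y/2)^2, and (1 - y/2)^2 (1 + y + y^2)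
    >= 1 in this range. *)
Lemma expR_le_quadratic (R : realType) (y : R) : y <= 3 / 8 ->
  expR y <= 1 + y + y ^+ 2.
Proof.
move=> y38.
have h0 : 0 < 1 - y / 2 by lra.
have h1 : (1 - y / 2) ^+ 2 <= expR (- y).
  rewrite (_ : expR (- y) = expR (- (y / 2)) ^+ 2); last first.
    by rewrite expr2 -expRD; congr expR; lra.
  by rewrite ler_sqr ?nnegrE ?expR_ge0 ?(ltW h0)//; exact: expR_ge1Dx.
(* The threshold 3/8 comes from 1 - 3 y + y^2 >= 0. *)
have h2 : 1 <= (1 - y / 2) ^+ 2 * (1 + y + y ^+ 2).
  rewrite -subr_ge0 (_ : _ - 1 = y ^+ 2 * ((1 - 3 * y + y ^+ 2) / 4)); last by field.
  rewrite mulr_ge0 ?sqr_ge0// divr_ge0//; nra.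
have q0 : 0 <= 1 + y + y ^+ 2 by nra.
rewrite -[leLHS]mulr1; apply: (le_trans (ler_wpM2l (expR_ge0 y) h2)).
rewrite mulrA -[leRHS]mul1r ler_wpM2r//.
apply: (le_trans (ler_wpM2l (expR_ge0 y) h1)).
by rewrite -expRD subrr expR0.
Qed.

Section density.
Context {d : measure_display} {T : measurableType d} {R : realType}.
Variable mu : {measure set T -> \bar R}.
Variables (f rho : T -> R) (s : R).
Hypothesis mf : measurable_fun setT f.
Hypothesis f_le : forall x, `|f x| <= s.
Hypothesis rho_ge0 : forall x, 0 <= rho x.
Hypothesis irho : mu.-integrable setT (EFin \o rho).

Lemma integrable_bounded_density (g : T -> R) (c : R) : measurable_fun setT g ->
  (forall x, `|g x| <= c) -> mu.-integrable setT (EFin \o (fun x => g x * rho x)).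
Proof.
move=> mg gc.
have mrho : measurable_fun setT rho by exact/measurable_EFinP/(measurable_int mu).
have icr : mu.-integrable setT (EFin \o (fun x => c * rho x)).
  exact (integrableZl measurableT c irho).
apply: (le_integrable _ _ _ icr) => //.
  by apply/measurable_EFinP; exact: measurable_funM.
move=> x _ /=; rewrite lee_fin normrM [leRHS]ger0_norm.
  by rewrite (ger0_norm (rho_ge0 x)) ler_wpM2r.
by rewrite mulr_ge0// (le_trans _ (gc x)).
Qed.

Hypothesis rho1 : \int[mu]_x rho x = 1.
Variable t : R.
Hypothesis ts : `|t| * (2 * s) <= 3 / 8.

Lemma measurable_expR_sub1 : measurable_fun setT (fun x => expR (t * f x) - 1).
Proof.
apply: measurable_funB => //; apply: measurableT_comp => //.
by apply: measurable_funM.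
Qed.

Lemma expR_sub1_bound x : `|expR (t * f x) - 1| <= expR (`|t| * s) + 1.
Proof.
apply: (le_trans (ler_normB _ _)); rewrite normr1 lerD2r.
rewrite (ger0_norm (expR_ge0 _)) ler_expR (le_trans (ler_norm _))// normrM.
by rewrite ler_wpM2l.
Qed.

Lemma bounded_expR_sub1 : bounded_fun (fun x => expR (t * f x) - 1).
Proof.
exists (expR (`|t| * s) + 1); split => // c c1 x _ /=.
exact: (le_trans (expR_sub1_bound x) (ltW c1)).
Qed.

(** Lets the upper bounds on the factors be multiplied. *)
Lemma laplace_density_ge0 : 0 <= 1 + \int[mu]_x ((expR (t * f x) - 1) * rho x).
Proof.
have i1 := integrable_bounded_density measurable_expR_sub1 expR_sub1_bound.
rewrite -{1}rho1 -RintegralD//; apply: Rintegral_ge0 => x _.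
by rewrite mulrBl mul1r addrC subrK mulr_ge0// expR_ge0.
Qed.

Lemma laplace_density_le :
  1 + \int[mu]_x ((expR (t * f x) - 1) * rho x) <=
  expR (t * (\int[mu]_x (f x * rho x)) + t ^+ 2 * s ^+ 2).
Proof.
have i1 := integrable_bounded_density measurable_expR_sub1 expR_sub1_bound.
have i2 := integrable_bounded_density mf f_le.
set m := \int[mu]_x (f x * rho x).
have m_le : `|m| <= s.
  apply: (le_trans (le_normr_Rintegral measurableT i2)).
  rewrite -[s]mulr1 -rho1 -RintegralZl//; apply: le_Rintegral => //.
  - exact (integrable_abse i2).
  - exact (integrableZl measurableT s irho).
  - by move=> x _; rewrite normrM (ger0_norm (rho_ge0 x)) ler_wpM2r.
pose E := expR (t * m).
pose b := E * (t - 2 * t ^+ 2 * m).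
pose a := E * (1 - t * m + t ^+ 2 * (s ^+ 2 + m ^+ 2)).
(* [f^2 <= s^2] bounds [(f - m)^2] by an affine function of [f], whose integral
   against [rho] only involves the mean [m]. *)
have key x : expR (t * f x) <= a + b * f x.
  rewrite (_ : t * f x = t * m + t * (f x - m)); last by ring.
  rewrite expRD -/E (_ : a + b * f x = E * (1 + t * (f x - m) +
    t ^+ 2 * (s ^+ 2 - 2 * m * f x + m ^+ 2))); last by rewrite /a /b; ring.
  rewrite ler_wpM2l ?expR_ge0//.
  have y38 : t * (f x - m) <= 3 / 8.
    apply: le_trans ts; apply: (le_trans (ler_norm _)).
    rewrite normrM ler_wpM2l// (le_trans (ler_normB _ _))//.
    by rewrite mulr2n mulrDl mul1r lerD.
  apply: (le_trans (expR_le_quadratic y38)); rewrite lerD2l exprMn.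
  rewrite ler_wpM2l ?sqr_ge0//.
  have : f x ^+ 2 <= s ^+ 2.
    by rewrite -real_normK ?num_real// ler_sqr ?nnegrE// (le_trans _ (f_le x)).
  by move=> ?; nra.
have -> : 1 + \int[mu]_x ((expR (t * f x) - 1) * rho x) =
    \int[mu]_x (expR (t * f x) * rho x).
  rewrite -{1}rho1 -RintegralD//; apply: eq_Rintegral => x _.
  by rewrite mulrBl mul1r addrC subrK.
have iaf : mu.-integrable setT (EFin \o (fun x => a * rho x)).
  exact (integrableZl measurableT a irho).
have ibf : mu.-integrable setT (EFin \o (fun x => b * (f x * rho x))).
  exact (integrableZl measurableT b i2).
apply: (@le_trans _ _ (\int[mu]_x (a * rho x + b * (f x * rho x)))).
  apply: le_Rintegral => //.
  - have := integrableD measurableT i1 irho.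
    apply: eq_integrable => // x _ /=.
    by rewrite -EFinD mulrBl mul1r subrK.
  - exact (integrableD measurableT iaf ibf).
  - by move=> x _; rewrite mulrA -mulrDl ler_wpM2r.
rewrite RintegralD// !RintegralZl// rho1 -/m expRD -/E.
(* Centring at the mean cancels the term of first order in t. *)
rewrite (_ : _ + _ = E * (1 + t ^+ 2 * (s ^+ 2 - m ^+ 2))); last first.
  by rewrite /a /b; ring.
rewrite ler_wpM2l ?expR_ge0//; apply: le_trans (expR_ge1Dx _).
by rewrite lerD2l ler_wpM2l ?sqr_ge0// lerBlDr lerDl sqr_ge0.
Qed.

End density.

Section laplace.
Context {d d' : measure_display} {T : measurableType d} {Omega : measurableType d'}.
Context {R : realType}.
Variable mu : {measure set T -> \bar R}.
Variables (K : T -> T -> R[i]) (N : nat) (P : probability Omega R).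
Variables (xi : Omega -> seq T).
Hypothesis pK : projection_kernel mu K N.
Hypothesis dxi : determinantal_process P mu K N xi.

(** K(x, x) is the one-point intensity, so this is the expected value of X_f;
    [expectation_linear_statistic] proves it. *)
Definition mean_statistic (f : T -> R) : R :=
  \int[mu]_x (f x * complex.Re (K x x)).

Lemma expR_linear_statistic (f : T -> R) (t : R) w :
  \prod_(x <- xi w) (1 + (expR (t * f x) - 1)) =
  expR (t * linear_statistic f xi w).
Proof.
rewrite /linear_statistic; elim: (xi w) => [|x r IH].
  by rewrite !big_nil mulr0 expR0.
by rewrite !big_cons IH mulrDr expRD addrC subrK.
Qed.

Lemma laplace_linear_statistic (f : T -> R) (s t : R) :
  measurable_fun setT f -> (forall x, `|f x| <= s) -> `|t| * (2 * s) <= 3 / 8 ->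
  ('E_P[fun w => expR (t * linear_statistic f xi w)] <=
    (expR (t * mean_statistic f + N%:R * (t ^+ 2 * s ^+ 2)))%:E)%E.
Proof.
move=> mf fs ts.
pose phi x := expR (t * f x) - 1.
have mphi : measurable_fun setT phi by exact: measurable_expR_sub1.
have bphi : bounded_fun phi by exact: bounded_expR_sub1.
have b1 : bounded_fun (cst 1 : T -> R).
  by exists 1; split => // x x1 y _ /=; rewrite normr1; exact: ltW.
have m1 : measurable_fun setT (cst 1 : T -> R) by exact: measurable_cst.
have [u [Lu uE KE]] := kernel_orthonormal_expansion pK.
(* Here the basis comes to depend on t. *)
have [Q [e [Q1 Q2 Qe]]] := combination_diagonalization mphi bphi Lu.
set v := combination Q u in Qe.
have Lv i : L2 mu (v i) by exact: L2_combination.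
have KvE x z : K x z = \sum_a v a x * conjc (v a z).
  by rewrite KE combination_kernel.
have winner1 g h : weighted_inner mu (cst 1) g h =
    cintegral mu (fun x => g x * conjc (h x)).
  by apply: cintegral_eq => x; rewrite /cst rmorph1 mul1r.
have vE i : \int[mu]_x sqnorm (v i x) = 1.
  apply: (@complexI R); rewrite -cintegral_real rmorph1.
  transitivity (weighted_inner mu (cst 1) (v i) (v i)).
    by rewrite winner1; apply: cintegral_eq => x; rewrite mulcJ_sqnorm.
  rewrite weighted_inner_combination//.
  transitivity (\sum_k Q i k * conjc (Q i k)); last by rewrite Q1 eqxx.
  apply: eq_bigr => k _; rewrite (bigD1 k)//= winner1 uE eqxx mulr1.
  by rewrite big1 ?addr0// => l lk; rewrite winner1 uE eq_sym (negbTE lk) mulr0.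
have irho i : mu.-integrable setT (EFin \o (fun x => sqnorm (v i x))) := (Lv i).2.
have eE i : e i = \int[mu]_x (phi x * sqnorm (v i x)).
  apply: (@complexI R); rewrite -cintegral_real -[LHS]mulr1.
  have := Qe i i; rewrite eqxx => <-.
  by apply: cintegral_eq => x; rewrite mulcJ_sqnorm -rmorphM.
rewrite (_ : (fun w => _) = (fun w => \prod_(x <- xi w) (1 + phi x))); last first.
  by apply/funext => w; rewrite expR_linear_statistic.
rewrite dxi.2// lee_fin (correlation_sum KvE _ Qe); last by move=> a b; exact: L2_mul.
have sumE : mean_statistic f = \sum_(i < N) \int[mu]_x (f x * sqnorm (v i x)).
  rewrite /mean_statistic.
  (* Integrability is carried through the induction because additivity of the integral requires it
     at each step. *)
  have /(_ (index_enum 'I_N)) : forall r : seq 'I_N,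
      mu.-integrable setT (EFin \o (fun x => \sum_(i <- r) f x * sqnorm (v i x))) /\
      \int[mu]_x (\sum_(i <- r) f x * sqnorm (v i x)) =
      \sum_(i <- r) \int[mu]_x (f x * sqnorm (v i x)).
    have iv i := integrable_bounded_density (fun x => sqnorm_ge0 (v i x)) (irho i) mf fs.
    elim=> [|i r [IH1 IH2]]; split.
    - by rewrite /comp; under eq_fun do rewrite big_nil; exact: integrable0.
    - by under eq_Rintegral do rewrite big_nil; rewrite big_nil /Rintegral integral0.
    - rewrite /comp; under eq_fun do rewrite big_cons.
      exact (integrableD measurableT (iv i) IH1).
    - under eq_Rintegral do rewrite big_cons.
      by rewrite RintegralD// IH2 big_cons.
  move=> [_ <-]; apply: eq_Rintegral => x _; rewrite -mulr_sumr; congr (_ * _).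
  rewrite KvE (eq_bigr (fun i => real_complex R (sqnorm (v i x)))).
    by rewrite -rmorph_sum.
  by move=> i _; rewrite mulcJ_sqnorm.
have -> : N%:R * (t ^+ 2 * s ^+ 2) = \sum_(i < N) t ^+ 2 * s ^+ 2.
  by rewrite sumr_const card_ord mulr_natl.
rewrite sumE mulr_sumr -big_split /= expR_sum; apply: ler_prod => i _; rewrite eE.
apply/andP; split.
  exact: (laplace_density_ge0 mf fs (fun x => sqnorm_ge0 (v i x)) (irho i) (vE i)).
exact: (laplace_density_le mf fs (fun x => sqnorm_ge0 (v i x)) (irho i) (vE i) ts).
Qed.

End laplace.

(** * Measurability of linear statistics *)

Import HBNNSimple.

Section measurability.
Context {d d' : measure_display} {T : measurableType d} {Omega : measurableType d'}.
Context {R : realType} (xi : Omega -> seq T).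
Hypothesis rxi : random_configuration xi.

(** For an indicator the statistic is a number of points, the only quantity whose measurability is
    assumed. *)
Lemma measurable_linear_statistic_indic (B : set T) : measurable B ->
  measurable_fun setT (linear_statistic (\1_B : T -> R) xi).
Proof.
move=> mB.
have -> : linear_statistic (\1_B : T -> R) xi =
    (fun n : nat => n%:R : R) \o (fun w => count [in B] (xi w)).
  apply/funext => w; rewrite /linear_statistic /=; elim: (xi w) => [|x r IH] /=.
    by rewrite big_nil.
  by rewrite big_cons IH natrD.
by apply: measurableT_comp; [|exact: rxi].
Qed.

Lemma measurable_linear_statistic_sfun (h : {nnsfun T >-> R}) :
  measurable_fun setT (linear_statistic h xi).
Proof.
have -> : linear_statistic h xi = (fun w => \sum_(y <- finmap.enum_fset (fset_set (range h)))
    y * linear_statistic (\1_(h @^-1` [set y]) : T -> R) xi w).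
  apply/funext => w; rewrite /linear_statistic.
  under eq_bigr do rewrite fimfunE fsbig_finite//=.
  by rewrite exchange_big; apply: eq_bigr => y _; rewrite mulr_sumr.
apply: measurable_sum => y; apply: measurable_funM => //.
by apply: measurable_linear_statistic_indic.
Qed.

(** Configurations are finite, so pointwise convergence of simple functions to f passes to the
    statistics at each outcome. *)
Lemma measurable_linear_statistic_ge0 (f : T -> R) : measurable_fun setT f ->
  (forall x, 0 <= f x) -> measurable_fun setT (linear_statistic f xi).
Proof.
move=> mf f0.
have mEf : measurable_fun setT (EFin \o f) by exact/measurable_EFinP.
pose h n := nnsfun_approx measurableT mEf n.
apply: (@measurable_fun_cvg _ _ _ _ (fun n => linear_statistic (h n) xi)).
  by move=> n; exact: measurable_linear_statistic_sfun.
move=> w _; rewrite /linear_statistic; elim: (xi w) => [|x r IH].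
  by under eq_fun do rewrite big_nil; rewrite big_nil; exact: cvg_cst.
under eq_fun do rewrite big_cons.
rewrite big_cons; apply: cvgD => //.
have /fine_cvgP[_] : EFin \o (fun n => h n x) @ \oo --> (f x)%:E.
  by apply: cvg_nnsfun_approx => // y _; rewrite /= lee_fin.
exact.
Qed.

Lemma measurable_linear_statistic (f : T -> R) : measurable_fun setT f ->
  measurable_fun setT (linear_statistic f xi).
Proof.
move=> mf.
have -> : linear_statistic f xi =
    (fun w => linear_statistic f^\+ xi w - linear_statistic f^\- xi w).
  apply/funext => w; rewrite /linear_statistic -sumrB; apply: eq_bigr => x _.
  by rewrite -[in LHS](funrposBneg f).
by apply: measurable_funB; apply: measurable_linear_statistic_ge0 => //;
  [exact: measurable_funrpos|exact: measurable_funrneg].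
Qed.

End measurability.

(** * Tail and moments from a local sub-Gaussian bound *)

(** The difference vanishes at 0 and has derivative e^x + e^(-x) - 2 >= (1 + x) + (1 - x) - 2 =
    0. *)
Lemma sinh_ge_id (R : realType) (h : R) : 0 <= h -> 2 * h <= expR h - expR (- h).
Proof.
pose g (x : R) := expR x - expR (- x) - 2 * x.
have dg (x : R) : is_derive x 1 g (expR x + expR (- x) - 2).
  have dN : is_derive x 1 (expR \o -%R) (- expR (- x)).
    have := is_derive1_comp (is_derive_expR (- x)) (is_deriveNid x 1).
    by rewrite mulrN1.
  have dZ : is_derive x 1 (2 *: (id : R -> R)) (2 *: (1 : R)).
    exact: is_deriveZ.
  by have := is_deriveB (is_deriveB (is_derive_expR x) dN) dZ; rewrite opprK /GRing.scale /= mulr1.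
move=> h0; rewrite -subr_ge0 -/(g h).
have -> : 0 = g 0 by rewrite /g oppr0 expR0 mulr0 subrr subr0.
apply: (@ger0_derive1_ndecry _ g 0) => //.
- move=> x _; rewrite derive1E (@derive_val _ _ _ _ _ _ _ (dg x)).
  have := expR_ge1Dx x; have := expR_ge1Dx (- x); lra.
- apply: derivable_within_continuous => x _; exact: (@ex_derive _ _ _ _ _ _ _ (dg x)).
Qed.

(** Apply [sinh_ge_id] at x/2 to e^x + e^(-x) - 2 = (e^(x/2) - e^(-x/2))^2. *)
Lemma cosh_ge_quadratic (R : realType) (x : R) :
  2 + x ^+ 2 <= expR x + expR (- x).
Proof.
wlog x0 : x / 0 <= x.
  move=> H; have [/H//|/ltW x0] := leP 0 x.
  by have := H (- x); rewrite oppr_ge0 sqrrN opprK addrC (addrC (expR (- x))) => /(_ x0); rewrite addrC.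
have h := @sinh_ge_id R (x / 2); have x20 : 0 <= x / 2 by lra.
have {h} := h x20; rewrite (_ : 2 * (x / 2) = x); last by field.
set a := expR (x / 2); set b := expR (- (x / 2)) => xab.
have -> : expR x = a ^+ 2 by rewrite /a expr2 -expRD; congr expR; field.
have -> : expR (- x) = b ^+ 2 by rewrite /b expr2 -expRD; congr expR; field.
have ab1 : a * b = 1 by rewrite /a /b -expRD subrr expR0.
have : x ^+ 2 <= (a - b) ^+ 2 by rewrite ler_sqr ?nnegrE// (le_trans x0).
by rewrite sqrrB ab1; lra.
Qed.

(** The passage to the limit t -> 0 for the moment bounds. *)
Lemma ler_linear_perturbation (R : realFieldType) (x y C eta : R) :
  0 <= C -> 0 < eta -> (forall t, 0 < t -> t <= eta -> x <= y + C * t) -> x <= y.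
Proof.
move=> C0 eta0 H; apply/ler_addgt0Pr => e e0.
have C1 : 0 < C + 1 by rewrite ltr_wpDl.
(* C + 1 rather than C keeps the quotient meaningful when C = 0. *)
have t0 : 0 < Num.min eta (e / (C + 1)) by rewrite lt_min eta0 divr_gt0.
apply: (le_trans (H _ t0 _)); first by rewrite ge_min lexx.
rewrite lerD2l; apply: (@le_trans _ _ (C * (e / (C + 1)))).
  by rewrite ler_wpM2l// ge_min lexx orbT.
by rewrite mulrA ler_pdivrMr// mulrC ler_wpM2l ?(ltW e0)// lerDl.
Qed.

Section local_subgaussian.
Context {d : measure_display} {Omega : measurableType d} {R : realType}.
Variables (P : probability Omega R) (Z : Omega -> R) (c t0 : R).
Hypothesis mZ : measurable_fun setT Z.
Hypothesis c_ge0 : 0 <= c.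
Hypothesis t0_gt0 : 0 < t0.
Hypothesis laplaceZ : forall t, `|t| <= t0 ->
  ('E_P[fun w => expR (t * Z w)] <= (expR (c * t ^+ 2))%:E)%E.

Let mexp t : measurable_fun setT (fun w => expR (t * Z w)).
Proof. by apply: measurableT_comp => //; exact: measurable_funM. Qed.

Let iexp t : `|t| <= t0 -> P.-integrable setT (EFin \o (fun w => expR (t * Z w))).
Proof.
move=> tt0; apply/integrableP; split; first exact/measurable_EFinP.
apply: le_lt_trans (ltry (expR (c * t ^+ 2))).
apply: le_trans (laplaceZ tt0); rewrite unlock.
by under eq_integral do rewrite /= ger0_norm ?expR_ge0//.
Qed.

Let int_exp_le t : `|t| <= t0 -> \int[P]_w expR (t * Z w) <= expR (c * t ^+ 2).
Proof.
move=> tt0; rewrite -lee_fin fineK ?integrable_fin_num//; last exact: iexp.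
by have := laplaceZ tt0; rewrite unlock.
Qed.

Let normt0 : `|t0| <= t0. Proof. by rewrite ger0_norm// ltW. Qed.
Let normNt0 : `|- t0| <= t0. Proof. by rewrite normrN. Qed.

Let i1 (r : R) : P.-integrable setT (EFin \o (fun=> r)).
Proof. exact: finite_measure_integrable_cst. Qed.

Let int1 (r : R) : \int[P]_w r = r.
Proof.
rewrite Rintegral_cst// -[RHS]mulr1; congr (_ * _).
by rewrite -[RHS]/(fine 1%E); congr fine; exact: probability_setT.
Qed.

Let iD (f g : Omega -> R) : P.-integrable setT (EFin \o f) ->
  P.-integrable setT (EFin \o g) -> P.-integrable setT (EFin \o (fun w => f w + g w)).
Proof. by move=> fi gi; exact (integrableD measurableT fi gi). Qed.

Let iZ (r : R) (f : Omega -> R) : P.-integrable setT (EFin \o f) ->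
  P.-integrable setT (EFin \o (fun w => r * f w)).
Proof. by move=> fi; exact (integrableZl measurableT r fi). Qed.

(** Two-sided exponential moments dominate: t0 |Z| <= e^(t0 Z) + e^(-t0 Z). *)
Lemma local_subgaussian_integrable : P.-integrable setT (EFin \o Z).
Proof.
apply: (le_integrable _ _ _ (iZ t0^-1 (iD (iexp normt0) (iexp normNt0)))) => //.
  exact/measurable_EFinP.
move=> w _ /=; rewrite lee_fin [leRHS]ger0_norm; last first.
  by rewrite mulr_ge0 ?invr_ge0 ?(ltW t0_gt0)// addr_ge0 ?expR_ge0.
rewrite ler_pdivlMl// -{1}(gtr0_norm t0_gt0) -normrM mulNr.
have := expR_ge1Dx (t0 * Z w); have := expR_ge1Dx (- (t0 * Z w)).
have := expR_ge0 (t0 * Z w); have := expR_ge0 (- (t0 * Z w)).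
by rewrite ler_norml => *; apply/andP; split; lra.
Qed.

Lemma local_subgaussian_sqr_integrable :
  P.-integrable setT (EFin \o (fun w => Z w ^+ 2)).
Proof.
apply: (le_integrable _ _ _ (iZ (t0 ^- 2) (iD (iexp normt0) (iexp normNt0)))) => //.
  by apply/measurable_EFinP; exact: measurable_funX.
move=> w _ /=; rewrite lee_fin !ger0_norm ?sqr_ge0//; last first.
  by rewrite mulr_ge0 ?invr_ge0 ?sqr_ge0// addr_ge0 ?expR_ge0.
rewrite ler_pdivlMl ?exprn_gt0// -exprMn mulNr.
by apply: le_trans (cosh_ge_quadratic _); rewrite lerDr.
Qed.

(** Below this bound both t and c t are at most 1/4, hence so is c t^2, which is within reach of
    [expR_le_quadratic]. *)
Let eta := Num.min t0 (4 * (c + 1))^-1.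

Let eta_gt0 : 0 < eta.
Proof. by rewrite lt_min t0_gt0 invr_gt0 mulr_gt0// ltr_wpDl. Qed.

Let expR_eta t : 0 < t -> t <= eta ->
  [/\ t <= t0, t <= 1, c * t ^+ 2 <= 1 &
    expR (c * t ^+ 2) <= 1 + c * t ^+ 2 + (c * t ^+ 2) ^+ 2].
Proof.
move=> t_gt0; rewrite le_min => /andP[tt0 tc].
have c1 : 0 < 4 * (c + 1) by rewrite mulr_gt0// ltr_wpDl.
move: tc; rewrite -[_^-1]mul1r ler_pdivlMr// => tc.
have ct0 : 0 <= c * t by rewrite mulr_ge0// ltW.
have t1 : t <= 1 / 4 by lra.
have ct : c * t <= 1 / 4 by lra.
have ct2 : c * t ^+ 2 <= 1 / 4.
  rewrite expr2 mulrA; apply: le_trans ct; rewrite ler_piMr//; lra.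
by split=> //; [lra|lra|apply: expR_le_quadratic; lra].
Qed.

(** From 1 + t Z <= e^(t Z) one gets t E Z <= e^(c t^2) - 1 <= 2 c t^2 for small t of either sign;
    divide by |t| and let it tend to 0. *)
Lemma local_subgaussian_mean : \int[P]_w Z w = 0.
Proof.
have H t : `|t| <= t0 -> t * (\int[P]_w Z w) <= expR (c * t ^+ 2) - 1.
  move=> tt0; have iZZ := local_subgaussian_integrable.
  rewrite -RintegralZl// lerBrDl -{1}(int1 1) -RintegralD//; last exact: iZ.
  apply: le_trans (int_exp_le tt0); apply: le_Rintegral => //.
  - by apply: iD => //; exact: iZ.
  - exact: iexp.
  - by move=> w _; exact: expR_ge1Dx.
apply/eqP; rewrite -normr_eq0 eq_le normr_ge0 andbT.
apply: (@ler_linear_perturbation _ _ _ (2 * c) eta) => //; first by rewrite mulr_ge0.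
move=> t t_gt0 teta; rewrite add0r.
have [tt0 t1 ct et] := expR_eta t_gt0 teta.
have ntt0 : `|t| <= t0 by rewrite gtr0_norm.
have := H t ntt0; have := H (- t); rewrite normrN => /(_ ntt0).
rewrite sqrrN => H1 H2.
have u0 : 0 <= c * t ^+ 2 by rewrite mulr_ge0// sqr_ge0.
have uu : (c * t ^+ 2) ^+ 2 <= c * t ^+ 2 by rewrite expr2 ler_piMr.
have E : expR (c * t ^+ 2) - 1 <= t * (2 * c * t).
  rewrite (_ : t * _ = 2 * (c * t ^+ 2)); last by ring.
  lra.
rewrite ler_norml; apply/andP; split; rewrite -(ler_pM2l t_gt0); lra.
Qed.

(** Adding the bounds at t and -t gives 2 + t^2 E Z^2 <= 2 e^(c t^2), whose expansion yields 2 c in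
    the limit. *)
Lemma local_subgaussian_variance :
  ('E_P[fun w => (Z w ^+ 2)%R] <= (2 * c)%:E)%E.
Proof.
have iZZ := local_subgaussian_sqr_integrable.
rewrite unlock -[leLHS]fineK; last exact: integrable_fin_num.
rewrite -/(Rintegral _ _ _) lee_fin.
apply: (@ler_linear_perturbation _ _ _ (2 * c ^+ 2) eta) => //.
  by rewrite mulr_ge0// sqr_ge0.
move=> t t_gt0 teta.
have [tt0 t1 ct et] := expR_eta t_gt0 teta.
have ntt0 : `|t| <= t0 by rewrite gtr0_norm.
have nntt0 : `|- t| <= t0 by rewrite normrN.
have H : 2 + t ^+ 2 * (\int[P]_w (Z w ^+ 2)) <= 2 * expR (c * t ^+ 2).
  rewrite -RintegralZl// -{1}(int1 2) -RintegralD//; last exact: iZ.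
  apply: (@le_trans _ _ (\int[P]_w (expR (t * Z w) + expR (- t * Z w)))).
    apply: le_Rintegral => //.
    - by apply: iD => //; exact: iZ.
    - by apply: iD; exact: iexp.
    - by move=> w _; rewrite -exprMn mulNr; exact: cosh_ge_quadratic.
  rewrite RintegralD//; [|exact: iexp|exact: iexp].
  have := int_exp_le ntt0; have := int_exp_le nntt0; rewrite sqrrN; lra.
have t2 : 0 < t ^+ 2 by rewrite exprn_gt0.
rewrite -(ler_pM2l t2).
(* As t <= 1, the error 2 c^2 t^2 may be weakened to the linear one in [ler_linear_perturbation]. *)
have t4 : t ^+ 2 * t ^+ 2 <= t ^+ 2 * t by rewrite ler_wpM2l ?(ltW t2)// expr2 ler_piMl ?(ltW t_gt0).
have : c ^+ 2 * (t ^+ 2 * t ^+ 2) <= c ^+ 2 * (t ^+ 2 * t) by rewrite ler_wpM2l ?sqr_ge0.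
move: H et; rewrite exprMn (expr2 (t ^+ 2)).
set V := Rintegral _ _ _; set E := expR _; set q := t ^+ 2 * t ^+ 2.
rewrite (_ : t ^+ 2 * (2 * c + 2 * c ^+ 2 * t) =
  2 * (c * t ^+ 2) + 2 * (c ^+ 2 * (t ^+ 2 * t))); last by ring.
lra.
Qed.

(** Chernoff's inequality for Z and for -Z; the factor 2 is the union bound. *)
Lemma local_subgaussian_tail (t a : R) : 0 < t -> t <= t0 ->
  (P [set w | (a <= `|Z w|)%R] <= (2 * expR (- (t * a) + c * t ^+ 2))%:E)%E.
Proof.
move=> t_gt0 tt0.
have ntt0 : `|t| <= t0 by rewrite gtr0_norm.
have nntt0 : `|- t| <= t0 by rewrite normrN.
have mNZ : measurable_fun setT (\- Z) by exact: measurable_funN.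
have tail (Y : {RV P >-> R}) :
    ('E_P[fun w => expR (t * Y w)] <= (expR (c * t ^+ 2))%:E)%E ->
    (P [set w | (a <= Y w)%R] <= (expR (- (t * a) + c * t ^+ 2))%:E)%E.
  move=> HY; apply: (le_trans (chernoff Y a t_gt0)).
  rewrite addrC expRD EFinM; apply: lee_wpmul2r; first by rewrite lee_fin expR_ge0.
  rewrite /mmt_gen_fun.
  rewrite (_ : _ \o _ = fun w => expR (t * Y w))//.
  by apply/funext => w /=; rewrite mulrC.
have mle (Y : Omega -> R) : measurable_fun setT Y ->
    measurable [set w | (a <= Y w)%R].
  move=> mY; rewrite -[X in measurable X]setTI.
  rewrite (_ : [set _ | _] = Y @^-1` `[a, +oo[%classic).
    by apply: mY => //; exact: measurable_itv.
  by apply/seteqP; split => w /=; rewrite in_itv/= andbT.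
have -> : [set w | (a <= `|Z w|)%R] =
    [set w | (a <= Z w)%R] `|` [set w | (a <= (\- Z) w)%R].
  by apply/seteqP; split => w /=; rewrite ler_normr => /orP.
apply: (le_trans (measureU2 P (mle _ mZ) (mle _ mNZ))).
rewrite mulrDl mul1r EFinD leeD//.
  by apply: (tail (mfun_Sub (mem_set mZ))); exact: laplaceZ.
apply: (tail (mfun_Sub (mem_set mNZ))); rewrite -[t ^+ 2]sqrrN.
have := laplaceZ nntt0.
by under [fun w => expR (- t * _)]eq_fun do rewrite mulNr -mulrN.
Qed.

End local_subgaussian.

(** * Mean, variance and tail of a linear statistic *)

Lemma norm_le_sup_norm (R : realType) (T : Type) (f : T -> R) x :
  bounded_fun f -> `|f x| <= sup_norm f.
Proof.
move=> [M [_ fM]]; apply: ub_le_sup; last by exists x.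
(* [bounded_fun] only promises bounds strictly above M. *)
exists (M + 1) => _ [y _ <-]; apply: (fM (M + 1)) => //.
by rewrite ltrDl.
Qed.

Lemma sup_norm_gt0 (R : realType) (T : Type) (f : T -> R) :
  bounded_fun f -> f <> cst 0 -> 0 < sup_norm f.
Proof.
move=> bf; apply: contra_notT; rewrite -leNgt => s0.
apply/funext => x; have := le_trans (norm_le_sup_norm x bf) s0.
by rewrite normr_le0 => /eqP.
Qed.

Section linear_statistic_bounds.
Context {d d' : measure_display} {T : measurableType d} {Omega : measurableType d'}.
Context {R : realType} {mu : {measure set T -> \bar R}}.
Context {K : T -> T -> R[i]} {N : nat} {P : probability Omega R}.
Context {xi : Omega -> seq T} {f : T -> R}.
Hypothesis pK : projection_kernel mu K N.
Hypothesis dxi : determinantal_process P mu K N xi.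
Hypothesis mf : measurable_fun setT f.
Hypothesis bf : bounded_fun f.

Local Notation X := (linear_statistic f xi).
Local Notation m := (mean_statistic mu K f).
Local Notation s := (sup_norm f).
Local Notation Z := (fun w => X w - m).
Local Notation c := (N%:R * s ^+ 2).

Let mX : measurable_fun setT X.
Proof. exact: measurable_linear_statistic dxi.1 _ mf. Qed.

Let mZ : measurable_fun setT Z.
Proof. exact: measurable_funB. Qed.

Let c_ge0 : 0 <= c.
Proof. by rewrite mulr_ge0 ?ler0n ?sqr_ge0. Qed.

Lemma sup_norm_ge0 : 0 <= s.
Proof. exact: le_trans (norm_le_sup_norm point bf). Qed.

Lemma laplace_centered (t : R) : `|t| * (2 * s) <= 3 / 8 ->
  ('E_P[fun w => expR (t * Z w)] <= (expR (c * t ^+ 2))%:E)%E.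
Proof.
move=> ts.
have := laplace_linear_statistic pK dxi mf (fun x => norm_le_sup_norm x bf) ts.
have -> : (fun w => expR (t * Z w)) = (fun w => expR (- (t * m)) * expR (t * X w)).
  by apply/funext => w; rewrite -expRD; congr expR; ring.
rewrite !unlock => H; under eq_integral do rewrite EFinM.
rewrite ge0_integralZl//; last first.
  by apply/measurable_EFinP; apply: measurableT_comp => //; exact: measurable_funM.
apply: (le_trans (lee_wpmul2l _ H)); first by rewrite lee_fin expR_ge0.
rewrite -EFinM -expRD lee_fin ler_expR.
by rewrite le_eqVlt; apply/orP; left; apply/eqP; ring.
Qed.

(** The moments only need some positive radius; s + 1 in place of s also covers f = 0. *)
Let t1 : R := 3 / (16 * (s + 1)).

Let t1_gt0 : 0 < t1.
Proof. by rewrite divr_gt0// mulr_gt0// ltr_wpDl// sup_norm_ge0. Qed.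

Let laplace_t1 t : `|t| <= t1 ->
  ('E_P[fun w => expR (t * Z w)] <= (expR (c * t ^+ 2))%:E)%E.
Proof.
move=> tt1; apply: laplace_centered.
have s0 := sup_norm_ge0; have s1 : 0 < s + 1 by lra.
have t16 : t1 * (s + 1) = 3 / 16 by rewrite /t1; field; rewrite gt_eqF.
have : `|t| * (s + 1) <= t1 * (s + 1) by rewrite ler_wpM2r// ltW.
have := normr_ge0 t; lra.
Qed.

Lemma expectation_linear_statistic : ('E_P[X] = m%:E)%E.
Proof.
have iZ := local_subgaussian_integrable mZ t1_gt0 laplace_t1.
have := local_subgaussian_mean mZ c_ge0 t1_gt0 laplace_t1.
have im : P.-integrable setT (EFin \o (fun=> m)).
  exact: finite_measure_integrable_cst.
have iX : P.-integrable setT (EFin \o X).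
  have := integrableD measurableT iZ im; apply: eq_integrable => // w _ /=.
  by rewrite -EFinD subrK.
rewrite RintegralB// Rintegral_cst//.
rewrite (_ : fine _ = 1); last first.
  by rewrite -[RHS]/(fine 1%E); congr fine; exact: probability_setT.
rewrite mulr1 => /eqP; rewrite subr_eq0 => /eqP <-.
by rewrite unlock fineK//; exact: integrable_fin_num.
Qed.

Lemma variance_linear_statistic : (variance P X <= (2 * N%:R * s ^+ 2)%:E)%E.
Proof.
have := local_subgaussian_variance mZ c_ge0 t1_gt0 laplace_t1.
rewrite mulrA /variance covariance.unlock expectation_linear_statistic /=.
by rewrite (_ : (fun w => _) = (X \- cst m) * (X \- cst m)).
Qed.

Lemma tail_linear_statistic (t eps : R) : 0 < t -> t * (2 * s) <= 3 / 8 ->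
  (P [set w | (eps <= `|X w - fine 'E_P[X]%E|)%R] <=
    (2 * expR (- (t * eps) + c * t ^+ 2))%:E)%E.
Proof.
move=> t_gt0 ts; rewrite expectation_linear_statistic /=.
(* Taking t itself as radius keeps the full range of t, beyond [t1]. *)
apply: (local_subgaussian_tail mZ (t0 := t)) => // t' t't.
apply: laplace_centered; apply: le_trans ts.
by rewrite ler_wpM2r// mulr_ge0// sup_norm_ge0.
Qed.

End linear_statistic_bounds.

Theorem theorem3p3 (R : realType) :
  exists A : R, 0 < A /\
  forall (Lambda : completeMetricType R)
    (lambda : {measure set (borel Lambda) -> \bar R})
    (K : borel Lambda -> borel Lambda -> R[i]) (N : nat)
    (d : measure_display) (Omega : measurableType d) (P : probability Omega R)
    (xi : Omega -> seq (borel Lambda)) (f : borel Lambda -> R),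
  separable_space Lambda ->
  locally_compact [set: Lambda] ->
  radon_measure lambda ->
  projection_kernel lambda K N ->
  determinantal_process P lambda K N xi ->
  measurable_fun [set: borel Lambda] f ->
  bounded_fun f ->
  let X := linear_statistic f xi in
  (variance P X <= (2 * N%:R * sup_norm f ^+ 2)%:E)%E /\
  (f <> cst 0 ->
   forall eps : R, 0 < eps ->
     (P [set w | (eps <= `|X w - fine 'E_P[X]%E|)%R] <=
      (if eps < 4 * A * N%:R * sup_norm f / 3
       then 2 * expR (- (eps ^+ 2 / (8 * A * N%:R * sup_norm f ^+ 2)))
       else 2 * expR (- (eps / (6 * sup_norm f))))%:E)%E).
Proof.
(* With A = 2 the regimes meet at eps = 8 N s / 3, where both exponents equal -eps / (6 s). *)
exists 2; split => // Lambda lambda K N d Omega P xi f _ _ _ pK dxi mf bf X.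
split; first exact: variance_linear_statistic pK dxi mf bf.
move=> /(sup_norm_gt0 bf); set s := sup_norm f => s_gt0 eps eps_gt0.
have s_neq0 : s != 0 by rewrite gt_eqF.
case: ifPn => [eps_lt|]; last rewrite -leNgt => eps_ge.
(* For N = 0 the threshold is 0, so this regime is empty. *)
- have N_gt0 : 0 < N%:R :> R.
    rewrite ltr0n lt0n; apply: contraTneq eps_lt => ->.
    by rewrite mulr0 !mul0r -leNgt ltW.
  have N_neq0 : N%:R != 0 :> R by rewrite gt_eqF.
  (* Proportional to eps and equal to the largest admissible value 3 / (16 s) at the threshold. The
     free minimizer eps / (2 N s^2) would leave the admissible range. *)
  pose t := 9 * eps / (128 * N%:R * s ^+ 2).
  have t_gt0 : 0 < t by rewrite divr_gt0 ?mulr_gt0 ?exprn_gt0.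
  have ts : t * (2 * s) <= 3 / 8.
    rewrite (_ : t * (2 * s) = 9 * eps / (64 * N%:R * s)); last first.
      by rewrite /t; field; rewrite s_neq0.
    by rewrite ler_pdivrMr ?mulr_gt0//; lra.
  apply: le_trans (tail_linear_statistic pK dxi mf bf eps t_gt0 ts) _.
  rewrite lee_fin ler_pM2l// ler_expR -/s.
  pose q := eps ^+ 2 / (N%:R * s ^+ 2).
  have q_ge0 : 0 <= q by rewrite divr_ge0 ?sqr_ge0// mulr_ge0 ?sqr_ge0.
  rewrite (_ : - (t * eps) + _ = - (9 / 128 - 81 / 16384) * q); last first.
    by rewrite /t /q; field; rewrite s_neq0.
  rewrite (_ : - (eps ^+ 2 / _) = - (1 / 16) * q); last first.
    by rewrite /q; field; rewrite s_neq0.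
  (* The comparison is 9/128 - 81/16384 = 1071/16384 >= 1024/16384 = 1/16. *)
  by rewrite ler_wpM2r//; lra.
- pose t := 3 / (16 * s).
  have t_gt0 : 0 < t by rewrite divr_gt0 ?mulr_gt0.
  have ts : t * (2 * s) <= 3 / 8.
    by rewrite le_eqVlt; apply/orP; left; apply/eqP; rewrite /t; field.
  apply: le_trans (tail_linear_statistic pK dxi mf bf eps t_gt0 ts) _.
  rewrite lee_fin ler_pM2l// ler_expR -/s.
  pose q := eps / s.
  (* Bounding N by 3 q / 8 leaves the exponent -(3/16 - 27/2048) q = -(357/2048) q, and 357/2048 >
     1/6. *)
  have q_ge : 8 / 3 * N%:R <= q by rewrite /q ler_pdivlMr//; lra.
  rewrite (_ : - (t * eps) + _ = - (3 / 16) * q + 9 / 256 * N%:R); last first.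
    by rewrite /t /q; field.
  rewrite (_ : - (eps / _) = - (1 / 6) * q); last by rewrite /q; field.
  have := ler0n R N; lra.
Qed.
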